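(* Assume that the initial-boundary value problem $$\frac{\partial u}{\partial t}=L(u)\ \text{ in }\Omega\times(t_0,T],\qquad u=g\ \text{ on }\partial\Omega,\qquad u=u^0\ \text{ on }\Omega\times\{t=t_0\}$$ is well posed and admits a unique nonnegative continuous exact solution $u=u(t,\boldsymbol{x})$. Assume also that the finite difference scheme $$B_1U^{n+1}=B_0U^n+F^n$$ for this problem satisfies, with positive constants $K$ and $K_1$, (i) $\|B_1^{-1}\|\le K_1$; (ii) (stability) $\|B_1^{-1}B_0\|\le 1+K\Delta t$; (iii) (consistency) $\frac{1}{\Delta t}\left[B_1u^{n+1}-B_0u^n-F^n\right]\longrightarrow \frac{\partial u}{\partial t}-L(u)$ as $\Delta t\,(h)\to 0$, i.e. as $\Delta t$ and $h$ tend to zero; (iv) $\|\tau^n\|\le C_{lte}(u)\,\Delta t\,(\Delta t^p+h^q)$, where $\tau^n=B_1u^{n+1}-B_0u^n-F^n$ is the local truncation error, $p$ and $q$ are positive integers, and $C_{lte}(u)$ is a constant depending only on the exact solution. Then the error for the cutoff solution procedure with this scheme, i.e. the procedure, starting from $u^0$ at $t=t_0$, in which the negative values of the computed solution are cut off at each time step and the time integration is continued with the corrected solution, $$B_1U^{n+1}=B_0(U^n)^{+}+F^n,$$ is bounded by $$\|(U^n)^{+}-u^n\|\le\|U^n-u^n\|\le\frac{K_1}{K}\,e^{Kt_n}\,C_{lte}(u)\,(\Delta t^p+h^q).$$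
   Context: $\Omega\subset\mathbb{R}^d$ ($d\ge1$) is the physical domain, $L$ is a linear elliptic differential operator, and $g$ and $u^0$ are given sufficiently smooth functions; for notational simplicity $L$ and $g$ are assumed not to contain $t$ explicitly. $\Delta t$ and $h$ are the maximal time step size and the maximal element size, respectively, $t_n$ are the time levels, and $\boldsymbol{x}_j$ are the mesh vertices. $u^n=\{u^n_j\}$ with $u^n_j=u(t_n,\boldsymbol{x}_j)$ are the exact solution values, and $U^n=\{U^n_j\}$ with $U^n_j\approx u^n_j$ is the numerical solution at $t=t_n$. $B_0$ and $B_1$ are matrices independent of $n$, and $F^n$ is the remaining given vector in the scheme. $\|\cdot\|$ is a proper matrix norm (the same symbol is used for vectors). The cutoff $(U^n)^{+}$ is the nonnegative part of $U^n$: its value at $\boldsymbol{x}_j$ is $U^n_j$ if $U^n_j\ge0$ and $0$ if $U^n_j\le0$.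
   Formalization: The formal theorem assumes t_0 ≥ 0, a uniform time step (t_n = t_0 + nΔt), and a compatible vector norm that is monotone in the absolute values of the components; without these the stated inequalities can fail. *)

(* Defs.v *)
From HB Require Import structures.
From mathcomp Require Import all_boot all_order all_algebra.
From mathcomp Require Import all_classical all_reals all_analysis.

Set Implicit Arguments.
Unset Strict Implicit.
Unset Printing Implicit Defensive.

Import Order.TTheory GRing.Theory Num.Theory.
Import numFieldNormedType.Exports.

Local Open Scope classical_set_scope.
Local Open Scope ring_scope.

Section PartialDerivatives.
Context {R : realType} {d : nat}.
Implicit Types (f : 'rV[R]_d -> R) (A : set 'rV[R]_d).

Definition partial (i : 'I_d) f : 'rV[R]_d -> R :=
  fun x => 'D_(delta_mx 0 i) f x.

(* Multi-indices whose components are at most m; those of length at most m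
   all have this form. *)
Definition mindex (m : nat) := {ffun 'I_d -> 'I_m.+1}.

Definition mlength m (alpha : mindex m) : nat := (\sum_(i < d) alpha i)%N.

Definition mpartial m (alpha : mindex m) f : 'rV[R]_d -> R :=
  foldr (fun i h => iter (alpha i) (partial i) h) f (enum 'I_d).

(* f is of class C^k on A; meaningful for open A. *)
Fixpoint Ck_on (k : nat) A f : Prop :=
  (forall x, A x -> {for x, continuous f}) /\
  if k is k'.+1 then
    forall i, (forall x, A x -> derivable f x (delta_mx 0 i)) /\
              Ck_on k' A (partial i f)
  else True.

Definition Ck_close (k : nat) A (delta : R) f f' : Prop :=
  forall alpha : mindex k, (mlength alpha <= k)%N ->
  forall x, A x -> `|mpartial alpha f x - mpartial alpha f' x| <= delta.

End PartialDerivatives.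

(* A linear differential operator
     L f x = \sum_(|alpha| <= m) a_alpha(x) D^alpha f(x),
   the coefficients of which do not depend on time. *)
Record diffop (R : realType) (d : nat) := Diffop {
  dord : nat;
  dcoef : @mindex d dord -> 'rV[R]_d -> R
}.

Definition dapply (R : realType) (d : nat) (L : diffop R d)
    (f : 'rV[R]_d -> R) (x : 'rV[R]_d) : R :=
  \sum_(alpha : mindex (dord L) | (mlength alpha <= dord L)%N)
     dcoef alpha x * mpartial alpha f x.

(* The principal symbol vanishes only at xi = 0. *)
Definition elliptic (R : realType) (d : nat) (Omega : set 'rV[R]_d)
    (L : diffop R d) : Prop :=
  (0 < dord L)%N /\
  forall x xi : 'rV[R]_d, Omega x -> xi != 0 ->
    \sum_(alpha : mindex (dord L) | mlength alpha == dord L)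
       dcoef alpha x * \prod_(i < d) xi 0 i ^+ alpha i != 0.

Section Problem.
Context {R : realType} {d : nat}.
Variables (Omega : set 'rV[R]_d) (L : diffop R d) (t0 T : R).
Implicit Types (g uin : 'rV[R]_d -> R) (u : R -> 'rV[R]_d -> R).

Definition is_domain : Prop :=
  [/\ open Omega, connected Omega & Omega !=set0].

Definition bdry : set 'rV[R]_d := closure Omega `\` interior Omega.

(* The time derivative is taken within [t0, T], hence is one-sided at T. *)
Definition tquot u (t : R) (x : 'rV[R]_d) : R -> R :=
  fun s => (s - t)^-1 * (u s x - u t x).

Definition tnear (t : R) := within `[t0, T] (t^').

Definition dtime u (t : R) (x : 'rV[R]_d) : R :=
  lim (tquot u t x @ tnear t).

Definition ibvp_solution g uin u : Prop :=
  [/\ {within `[t0, T] `*` closure Omega,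
        continuous (fun z : R * 'rV[R]_d => u z.1 z.2)},
      forall t x, t0 < t <= T -> Omega x ->
        [/\ Ck_on (dord L) Omega (u t),
            cvg (tquot u t x @ tnear t) &
            dtime u t x = dapply L (u t) x],
      forall t x, t0 <= t <= T -> bdry x -> u t x = g x &
      forall x, Omega x -> u t0 x = uin x].

(* The boundary function g only matters near the boundary, and uin in Omega. *)
Definition smooth_data (s : nat) g uin : Prop :=
  (exists V : set 'rV[R]_d, [/\ open V, bdry `<=` V & Ck_on s V g]) /\
  Ck_on s Omega uin.

(* Well-posedness in the sense of Hadamard: existence, uniqueness, and
   continuous dependence of the solution (sup norm) on the data (C^s norm). *)
Definition well_posed (s : nat) g uin : Prop :=
  [/\ exists u, ibvp_solution g uin u,
      forall u v, ibvp_solution g uin u -> ibvp_solution g uin v ->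
        forall t x, t0 <= t <= T -> closure Omega x -> u t x = v t x &
      forall u, ibvp_solution g uin u -> forall eps : R, 0 < eps ->
        exists2 delta : R, 0 < delta &
          forall g' uin' v, smooth_data s g' uin' ->
            Ck_close s bdry delta g g' -> Ck_close s Omega delta uin uin' ->
            ibvp_solution g' uin' v ->
            forall t x, t0 <= t <= T -> closure Omega x ->
              `|u t x - v t x| <= eps].

End Problem.

(* A matrix norm together with a vector norm compatible with it.  The vector
   norm is monotone in the absolute values of the components, as the usual
   (weighted) l^p norms are: for an arbitrary vector norm, cutting off negative
   values may increase the error. *)
Record proper_norm (R : realType) (n : nat) := ProperNorm {
  vnorm : 'cV[R]_n -> R;
  mnorm : 'M[R]_n -> R;
  vnorm_eq0 : forall (x : 'cV[R]_n), vnorm x = 0 -> x = 0;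
  vnormD : forall (x y : 'cV[R]_n), vnorm (x + y) <= vnorm x + vnorm y;
  vnormZ : forall (a : R) (x : 'cV[R]_n), vnorm (a *: x) = `|a| * vnorm x;
  vnorm_mono : forall (x y : 'cV[R]_n),
    (forall i, `|x i 0| <= `|y i 0|) -> vnorm x <= vnorm y;
  mnorm_eq0 : forall (A : 'M[R]_n), mnorm A = 0 -> A = 0;
  mnormD : forall (A B : 'M[R]_n), mnorm (A + B) <= mnorm A + mnorm B;
  mnormZ : forall (a : R) (A : 'M[R]_n), mnorm (a *: A) = `|a| * mnorm A;
  mnormM : forall (A B : 'M[R]_n), mnorm (A *m B) <= mnorm A * mnorm B;
  vnormM : forall (A : 'M[R]_n) (x : 'cV[R]_n),
    vnorm (A *m x) <= mnorm A * vnorm x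
}.

(* One instance of the scheme B1 U^{n+1} = B0 U^n + F^n: a time step, a mesh
   (vertices, and elements given by their sets of vertices), and the matrices
   and vectors of the scheme.  The unknowns sit at the vertices selected by
   [dof]: all of them, or e.g. only the interior ones when the boundary values
   have been eliminated into F. *)
Record scheme (R : realType) (d : nat) := Scheme {
  dt : R;
  nv : nat;
  vertex : 'I_nv -> 'rV[R]_d;
  elements : {set {set 'I_nv}};
  ndof : nat;
  dof : 'I_ndof -> 'I_nv;
  B0 : 'M[R]_ndof;
  B1 : 'M[R]_ndof;
  Fvec : nat -> 'cV[R]_ndof;
  nrm : proper_norm R ndof
}.

Section Scheme.
Context {R : realType} {d : nat}.
Variables (Omega : set 'rV[R]_d) (L : diffop R d) (t0 T : R).
Variable D : scheme R d.
Implicit Types (g uin : 'rV[R]_d -> R) (u : R -> 'rV[R]_d -> R).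

Definition euclid (x y : 'rV[R]_d) : R :=
  Num.sqrt (\sum_(k < d) (x 0 k - y 0 k) ^+ 2).

Definition mesh_size : R :=
  \big[Num.max/0]_(E in elements D) \big[Num.max/0]_(i in E)
    \big[Num.max/0]_(j in E) euclid (vertex i) (vertex j).

Definition tlevel (n : nat) : R := t0 + n%:R * dt D.

Definition node (j : 'I_(ndof D)) : 'rV[R]_d := vertex (dof j).

Definition is_scheme : Prop :=
  [/\ 0 < dt D /\ tlevel 1 <= T,
      injective (@vertex _ _ D) /\ forall i, closure Omega (@vertex _ _ D i),
      forall i : 'I_(nv D), exists2 E, E \in elements D & i \in E,
      injective (@dof _ _ D) &
      B1 D \in unitmx].

Definition exact_vec u (n : nat) : 'cV[R]_(ndof D) :=
  \col_j u (tlevel n) (node j).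

Definition trunc_err u (n : nat) : 'cV[R]_(ndof D) :=
  B1 D *m exact_vec u n.+1 - B0 D *m exact_vec u n - Fvec D n.

(* du/dt - L(u) at the interior nodes at time t; the equation is not posed on
   the boundary, where the target is 0. *)
Definition pde_residual u (t : R) : 'cV[R]_(ndof D) :=
  \col_j (if node j \in Omega
          then dtime t0 T u t (node j) - dapply L (u t) (node j) else 0).

Definition cutoff n (U : 'cV[R]_n) : 'cV[R]_n :=
  \col_j (if 0 <= U j 0 then U j 0 else 0).

Definition initial_vec g uin : 'cV[R]_(ndof D) :=
  \col_j (if node j \in Omega then uin (node j) else g (node j)).

Definition cutoff_procedure g uin (U : nat -> 'cV[R]_(ndof D)) : Prop :=
  U 0%N = initial_vec g uin /\
  forall n, tlevel n.+1 <= T ->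
    B1 D *m U n.+1 = B0 D *m cutoff (U n) + Fvec D n.

End Scheme.

(* (1/dt) tau^n -> du/dt - L(u) as dt, h -> 0, uniformly in n.  The right-hand
   side is taken at t_{n+1}, since du/dt need not exist at t_0. *)
Definition consistent (R : realType) (d : nat) (Omega : set 'rV[R]_d)
    (L : diffop R d) (t0 T : R) (I : Type) (D : I -> scheme R d)
    (u : R -> 'rV[R]_d -> R) : Prop :=
  forall eps : R, 0 < eps -> exists2 delta : R, 0 < delta &
    forall i, dt (D i) < delta -> mesh_size (D i) < delta ->
    forall n, tlevel t0 (D i) n.+1 <= T ->
      vnorm (nrm (D i))
        ((dt (D i))^-1 *: trunc_err t0 (D i) u n -
         pde_residual Omega L t0 T (D i) u (tlevel t0 (D i) n.+1)) < eps.

(* Main.v *)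
(* Since the exact values are nonnegative, the cutoff moves every component of
   the numerical solution towards the exact one, so it does not increase a
   monotone norm of the error.  The error e_n = U^n - u^n hence satisfies
   |e_{n+1}| <= (1 + K dt) |e_n| + K1 C dt P, with P = dt^p + h^q, exactly as
   for the scheme without cutoff, and e_0 = 0.  A discrete Gronwall argument
   gives |e_n| <= K1/K C P ((1 + K dt)^n - 1), and (1 + K dt)^n <= exp (K t_n). *)

Require Import Defs.
From HB Require Import structures.
From mathcomp Require Import all_boot all_order all_algebra.
From mathcomp Require Import all_classical all_reals all_analysis.
From mathcomp Require Import ring lra.

Set Implicit Arguments.
Unset Strict Implicit.
Unset Printing Implicit Defensive.

Import Order.TTheory GRing.Theory Num.Theory.
Import numFieldNormedType.Exports.

Local Open Scope classical_set_scope.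
Local Open Scope ring_scope.

Section ProperNormTheory.
Context {R : realType} {n : nat} (N : proper_norm R n).
Implicit Types x y : 'cV[R]_n.

Lemma vnorm0 : vnorm N 0 = 0.
Proof. by rewrite -(scale0r (0 : 'cV[R]_n)) vnormZ normr0 mul0r. Qed.

(** Comes from monotonicity: the zero vector is dominated componentwise by every [x]. *)
Lemma vnorm_ge0 x : 0 <= vnorm N x.
Proof.
by rewrite -vnorm0; apply: vnorm_mono => j; rewrite mxE normr0 normr_ge0.
Qed.

Lemma vnormB x y : vnorm N (x - y) <= vnorm N x + vnorm N y.
Proof.
by rewrite (le_trans (vnormD _ _ _))// -scaleN1r vnormZ normrN1 mul1r.
Qed.

Lemma vnorm_cutoffB (U v : 'cV[R]_n) : (forall j, 0 <= v j 0) ->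
  vnorm N (cutoff U - v) <= vnorm N (U - v).
Proof.
move=> v_ge0; apply: vnorm_mono => j; rewrite !mxE.
case: (leP 0 (U j 0)) => // Uj_lt0; have vj_ge0 := v_ge0 j.
(* A negative entry is cut to 0, and the claim becomes [v j 0 <= v j 0 - U j 0]. *)
by rewrite sub0r normrN ger0_norm// ler0_norm; lra.
Qed.

End ProperNormTheory.

(** The recursion says that [e n + c] grows by a factor of at most [1 + k] per step; writing the
    source as [k * c] avoids dividing by [k]. The range stops at [m] because the scheme runs only up
    to time [T]. *)
Lemma discrete_gronwall (R : realFieldType) (k c : R) (e : nat -> R) (m : nat) :
  0 <= k -> e 0%N <= 0 ->
  (forall n, (n < m)%N -> e n.+1 <= (1 + k) * e n + k * c) ->
  forall n, (n <= m)%N -> e n <= c * ((1 + k) ^+ n - 1).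
Proof.
move=> k_ge0 e0 eS; elim=> [_|n IHn lt_nm]; first by rewrite expr0 subrr mulr0.
apply: le_trans (eS n lt_nm) _; rewrite exprS.
have /(ler_wpM2l (_ : 0 <= 1 + k)) := IHn (ltnW lt_nm).
by move=> /(_ ltac:(lra)); lra.
Qed.

Lemma expr1D_le_expR (R : realType) (k : R) (n : nat) :
  0 <= k -> (1 + k) ^+ n <= expR (n%:R * k).
Proof.
move=> k_ge0; rewrite expRM_natl lerXn2r ?nnegrE ?expR_ge0 ?expR_ge1Dx//.
by rewrite addr_ge0.
Qed.

Section CutoffProcedure.
Context {R : realType} {d : nat}.
Variables (Omega : set 'rV[R]_d) (L : diffop R d) (t0 T : R) (D : scheme R d).
Hypothesis hD : is_scheme Omega t0 T D.
Implicit Types (g uin : 'rV[R]_d -> R) (u : R -> 'rV[R]_d -> R).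

Lemma node_closure j : closure Omega (@node _ _ D j).
Proof. by case: hD => _ [_ +] _ _ _; apply. Qed.

Lemma le_tlevel m n : (m <= n)%N -> tlevel t0 D m <= tlevel t0 D n.
Proof.
case: hD => -[dt_gt0 _] _ _ _ _ le_mn.
by rewrite /tlevel lerD2l ler_wpM2r ?ler_nat// ltW.
Qed.

Lemma tlevel0 : tlevel t0 D 0 = t0.
Proof. by rewrite /tlevel mul0r addr0. Qed.

Lemma exact_vec_ge0 u n :
  (forall t x, t0 <= t <= T -> closure Omega x -> 0 <= u t x) ->
  tlevel t0 D n <= T -> forall j, 0 <= exact_vec t0 D u n j 0.
Proof.
move=> u_ge0 tnT j; rewrite mxE; apply: u_ge0; last exact: node_closure.
by rewrite tnT andbT -[leLHS]tlevel0 le_tlevel.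
Qed.

(** Nodes lie in the closure of [Omega], so a node outside [Omega] is a boundary point, where the
    boundary condition at [t0] gives the value. *)
Lemma initial_vec_exact g uin u : open Omega -> t0 <= T ->
  ibvp_solution Omega L t0 T g uin u ->
  initial_vec Omega D g uin = exact_vec t0 D u 0.
Proof.
move=> oOmega t0T [_ _ ubdry uinit]; apply/colP => j; rewrite !mxE tlevel0.
case: ifPn => [/set_mem xO|/negP xO]; first by rewrite uinit.
rewrite ubdry ?lexx//; split; first exact: node_closure.
by move=> /interior_subset xO'; apply: xO; rewrite inE.
Qed.

(* B1 u^{n+1} = B0 u^n + F^n + tau^n is subtracted from the scheme. *)
Lemma cutoff_error_step g uin u U n :
  cutoff_procedure Omega t0 T g uin U -> tlevel t0 D n.+1 <= T ->
  U n.+1 - exact_vec t0 D u n.+1 =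
  invmx (B1 D) *m B0 D *m (cutoff (U n) - exact_vec t0 D u n)
  - invmx (B1 D) *m trunc_err t0 D u n.
Proof.
move=> [_ hU] tnT; case: hD => _ _ _ _ B1u.
rewrite -mulmxA -mulmxBr; apply: (canRL (mulKmx B1u)).
rewrite !mulmxBr hU// /trunc_err !opprB addrA.
by apply/colP => j; rewrite !mxE; lra.
Qed.

End CutoffProcedure.

Theorem theorem2p1 (R : realType) (d : nat) (hd : (0 < d)%N)
    (Omega : set 'rV[R]_d) (hOmega : is_domain Omega)
    (L : diffop R d) (hL : elliptic Omega L)
    (t0 T : R) (ht0 : 0 <= t0) (hT : t0 < T)
    (s : nat) (g uin : 'rV[R]_d -> R) (hdata : smooth_data Omega s g uin)
    (hwp : well_posed Omega L t0 T s g uin)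
    (u : R -> 'rV[R]_d -> R)
    (hu : ibvp_solution Omega L t0 T g uin u)
    (hu_ge0 : forall t x, t0 <= t <= T -> closure Omega x -> 0 <= u t x)
    (I : Type) (D : I -> scheme R d)
    (hD : forall i, is_scheme Omega t0 T (D i))
    (K K1 : R) (hK : 0 < K) (hK1 : 0 < K1)
    (p q : nat) (hp : (0 < p)%N) (hq : (0 < q)%N)
    (Clte : (R -> 'rV[R]_d -> R) -> R)
    (h_inv : forall i, mnorm (nrm (D i)) (invmx (B1 (D i))) <= K1)
    (h_stab : forall i,
       mnorm (nrm (D i)) (invmx (B1 (D i)) *m B0 (D i)) <= 1 + K * dt (D i))
    (h_cons : consistent Omega L t0 T D u)
    (h_lte : forall i n, tlevel t0 (D i) n.+1 <= T ->
       vnorm (nrm (D i)) (trunc_err t0 (D i) u n) <=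
       Clte u * dt (D i) * (dt (D i) ^+ p + mesh_size (D i) ^+ q)) :
  forall (i : I) (U : nat -> 'cV[R]_(ndof (D i))),
    cutoff_procedure Omega t0 T g uin U ->
    forall n, tlevel t0 (D i) n <= T ->
      vnorm (nrm (D i)) (cutoff (U n) - exact_vec t0 (D i) u n) <=
        vnorm (nrm (D i)) (U n - exact_vec t0 (D i) u n) /\
      vnorm (nrm (D i)) (U n - exact_vec t0 (D i) u n) <=
        K1 / K * expR (K * tlevel t0 (D i) n) * Clte u *
        (dt (D i) ^+ p + mesh_size (D i) ^+ q).
Proof.
move=> i U hU n tnT.
have cutoff_le m : tlevel t0 (D i) m <= T ->
    vnorm (nrm (D i)) (cutoff (U m) - exact_vec t0 (D i) u m) <=
    vnorm (nrm (D i)) (U m - exact_vec t0 (D i) u m).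
  by move=> tmT; apply: vnorm_cutoffB; exact: exact_vec_ge0 (hD i) _ _ hu_ge0 tmT.
split; first exact: cutoff_le.
have [[dt_gt0 t1T] _ _ _ _] := hD i.
have [oOmega _ _] := hOmega.
set N := nrm (D i); set P := _ ^+ p + _ ^+ q.
pose e m := vnorm N (U m - exact_vec t0 (D i) u m).
(* Chosen so that [K * dt * c] is [K1] times the truncation bound, the source term of the Gronwall
   recursion with [k = K * dt]. *)
pose c := K1 / K * (Clte u * P).
(* The sign is read off from the truncation bound at step 0, available since [tlevel 1 <= T]: a norm
   is at most [dt * (Clte u * P)] with [dt > 0]. *)
have CP_ge0 : 0 <= Clte u * P.
  have := le_trans (vnorm_ge0 _ _) (h_lte i 0%N t1T).
  by rewrite mulrAC pmulr_lge0.
have c_ge0 : 0 <= c by rewrite mulr_ge0// divr_ge0// ltW.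
have k_ge0 : 0 <= K * dt (D i) by rewrite mulr_ge0 ?ltW.
have e0 : e 0%N <= 0.
  have [U0 _] := hU.
  by rewrite /e U0 (initial_vec_exact (hD i) oOmega (ltW hT) hu) subrr vnorm0.
have eS m : (m < n)%N ->
    e m.+1 <= (1 + K * dt (D i)) * e m + K * dt (D i) * c.
  (* Both time levels of the step are at most [T], so the scheme, the truncation bound and the
     cutoff estimate all apply. *)
  move=> lt_mn; have tSmT := le_trans (le_tlevel (hD i) lt_mn) tnT.
  have tmT := le_trans (le_tlevel (hD i) (leqnSn m)) tSmT.
  rewrite /e (cutoff_error_step (hD i) u hU tSmT).
  apply: le_trans (vnormB _ _ _) _; apply: lerD.
    apply: le_trans (vnormM _ _ _) _.
    apply: le_trans (ler_wpM2r (vnorm_ge0 _ _) (h_stab i)) _.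
    by rewrite ler_wpM2l ?cutoff_le// addr_ge0.
  apply: le_trans (vnormM _ _ _) _.
  apply: le_trans (ler_wpM2r (vnorm_ge0 _ _) (h_inv i)) _.
  apply: le_trans (ler_wpM2l (ltW hK1) (h_lte i m tSmT)) _.
  rewrite le_eqVlt; apply/orP; left; apply/eqP; rewrite /c /P.
  by field; exact: lt0r_neq0.
have := discrete_gronwall k_ge0 e0 eS (leqnn n).
rewrite -/(e n) => /le_trans; apply.
(* The common factor [c] is nonnegative; it remains to compare [(1 + K dt)^n - 1] with the
   exponential. *)
rewrite -[leRHS]mulrA [leRHS]mulrAC -/c; apply: ler_wpM2l => //.
apply: le_trans (_ : (1 + K * dt (D i)) ^+ n <= _); first by rewrite gerBl.
apply: le_trans (expr1D_le_expR n k_ge0) _.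
(* Here [K t_n = K t0 + n K dt], and [0 <= t0] lets the exponent grow from [n K dt] to [K t_n]. *)
by rewrite ler_expR /tlevel mulrDr mulrCA lerDr mulr_ge0// ltW.
Qed.
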